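(* For all $n\in\mathbb N$ and all $\rho\in[0,1)$ we have $Q_n(\rho)\le Q_\infty(\rho)\le e^2$.
   Context: $\mathbb N=\{0,1,2,\dots\}$. For $\rho\in(0,1)$ and $r\in[0,1]$ let $V_\rho(r)=\min_{\beta\in[0,1]}1-\beta+\rho\beta^2+\rho\beta(r-1)$, and let $R_0^*(\rho)=1$ and $R_n^*(\rho)=V_\rho(R_{n-1}^*(\rho))$ for $n\ge1$. Define $$Q_n(\rho)=\frac{1-\rho^{n+1}}{1-\rho}\cdot\frac{R_n^*(\rho)}{\rho^n}\qquad(n\in\mathbb N).$$ (This is the ratio between $\kappa_0R_n^*(\rho)$ with $\kappa_0=(1+\rho)\|x^0-x^*\|$, the minimax-optimal residual bound for Halpern iterations in normed spaces, and $\|x^0-x^*\|\rho^n(1-\rho^2)/(1-\rho^{n+1})$, the optimal bound in Hilbert spaces.) Let $n_0(\rho)$ be the smallest integer $n\in\mathbb N$ with $R_n^*(\rho)\le 1/\rho-1$. For fixed $\rho$, $Q_n(\rho)$ converges as $n\to\infty$ to $$Q_\infty(\rho)=\frac{R_{n_0}^*(\rho)}{(1-\rho)\rho^{n_0}},\qquad n_0=n_0(\rho).$$ At $\rho=0$ the values are understood as the limits for $\rho\downarrow0$, namely $Q_n(0)=Q_\infty(0)=1$. *)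

(* Defs.v *)
From mathcomp Require Import all_boot all_order all_algebra.
From mathcomp Require Import all_classical all_reals all_analysis.
From mathcomp Require Import ring lra.

Set Implicit Arguments.
Unset Strict Implicit.
Unset Printing Implicit Defensive.
Import Order.TTheory GRing.Theory Num.Theory.
Import numFieldNormedType.Exports.

Local Open Scope classical_set_scope.
Local Open Scope ring_scope.

Section Definitions.
Variable R : realType.
Implicit Types (rho r b : R) (n : nat).

Definition objective rho r b : R :=
  1 - b + rho * b ^+ 2 + rho * b * (r - 1).

(* [inf] is total; [valfun_min] shows that here it is an attained minimum. *)
Definition valfun rho r : R := inf [set objective rho r b | b in `[0, 1]].

Fixpoint Rstar rho n : R :=
  if n is m.+1 then valfun rho (Rstar rho m) else 1.

(* The default value 0 is never used for 0 < rho < 1, see [n0_least]. *)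
Definition n0 rho : nat :=
  xget 0%N [set n | Rstar rho n <= rho^-1 - 1 /\
                    forall m, Rstar rho m <= rho^-1 - 1 -> (n <= m)%N].

(* The value 1 at rho = 0 is the limit for rho decreasing to 0, see
   [Q_cvg_at0] and [Qinf_cvg_at0]. *)
Definition Q n rho : R :=
  if rho == 0 then 1
  else (1 - rho ^+ n.+1) / (1 - rho) * (Rstar rho n / rho ^+ n).

(* This closed form is the limit of [Q n rho] for n -> oo, see [Q_cvg_Qinf]. *)
Definition Qinf rho : R :=
  if rho == 0 then 1
  else Rstar rho (n0 rho) / ((1 - rho) * rho ^+ n0 rho).

End Definitions.

Section Facts.
Variable R : realType.
Implicit Types (rho r b : R) (n : nat).

Lemma valfun_eq rho r b : b \in `[0, 1] ->
  (forall c, c \in `[0, 1] -> objective rho r b <= objective rho r c) ->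
  valfun rho r = objective rho r b.
Proof.
move=> b01 bmin; apply/eqP; rewrite eq_le; apply/andP; split.
  by apply: ge_inf; [exists (objective rho r b) => _ [c c01 <-]; exact: bmin
                    |exists b].
by apply: lb_le_inf; [exists (objective rho r b), b|move=> _ [c c01 <-]; exact: bmin].
Qed.

Lemma valfun_small rho r : 0 < rho -> r <= rho^-1 - 1 -> valfun rho r = rho * r.
Proof.
move=> rho0 hr; rewrite (@valfun_eq _ _ 1) /objective; first by ring.
  by rewrite in_itv /= ler01 lexx.
move=> c; rewrite in_itv /= => /andP[c0 c1].
have h : rho * r <= 1 - rho.
  by rewrite -(ler_pM2l rho0) mulrBr mulfV ?gt_eqF// mulr1 in hr.
have h1 : 0 <= (1 - c) * (1 - rho - rho * r) by apply: mulr_ge0; lra.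
have h2 : 0 <= rho * (1 - c) ^+ 2 by apply: mulr_ge0; [lra|exact: sqr_ge0].
rewrite -subr_ge0.
suff -> : 1 - c + rho * c ^+ 2 + rho * c * (r - 1) -
  (1 - 1 + rho * 1 ^+ 2 + rho * 1 * (r - 1)) =
  (1 - c) * (1 - rho - rho * r) + rho * (1 - c) ^+ 2 by lra.
by ring.
Qed.

Lemma valfun_large rho r : 0 < rho -> rho^-1 - 1 <= r -> r <= 1 ->
  valfun rho r = 1 - (1 + rho * (1 - r)) ^+ 2 / (4 * rho).
Proof.
move=> rho0 hr r1.
have h : 1 - rho <= rho * r.
  by rewrite -(ler_pM2l rho0) mulrBr mulfV ?gt_eqF// mulr1 in hr.
have hN : 0 <= rho * (1 - r) by apply: mulr_ge0; lra.
rewrite (@valfun_eq _ _ ((1 + rho * (1 - r)) / (2 * rho))) /objective.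
- by field; rewrite gt_eqF.
- rewrite in_itv /= divr_ge0 ?ler_pdivrMr ?mul1r; [|lra|lra|lra].
  lra.
- move=> c _; rewrite -subr_ge0.
  suff -> : 1 - c + rho * c ^+ 2 + rho * c * (r - 1) -
    (1 - (1 + rho * (1 - r)) / (2 * rho) +
     rho * ((1 + rho * (1 - r)) / (2 * rho)) ^+ 2 +
     rho * ((1 + rho * (1 - r)) / (2 * rho)) * (r - 1)) =
    rho * (c - (1 + rho * (1 - r)) / (2 * rho)) ^+ 2.
    by apply: mulr_ge0; [lra|exact: sqr_ge0].
  by field; rewrite gt_eqF.
Qed.

Lemma valfun_min rho r : 0 < rho < 1 -> 0 <= r <= 1 ->
  exists2 b, b \in `[0, 1] &
    valfun rho r = objective rho r b /\
    forall c, c \in `[0, 1] -> objective rho r b <= objective rho r c.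
Proof.
move=> /andP[rho0 rho1] /andP[r0 r1].
have lb c : c \in `[0, 1] -> valfun rho r <= objective rho r c.
  move=> c01; apply: ge_inf; last by exists c.
  exists (- 1) => _ [b b01 <-]; move: b01; rewrite /= in_itv /= => /andP[b0 b1].
  rewrite /objective.
  have h1 : 0 <= rho * b * r by rewrite !mulr_ge0// ltW.
  have h2 : 0 <= rho * b ^+ 2 by rewrite mulr_ge0 ?sqr_ge0// ltW.
  have h3 : 0 <= (1 - rho) * b by rewrite mulr_ge0// subr_ge0 ltW.
  lra.
suff [b b01 bE] : exists2 b, b \in `[0, 1] & valfun rho r = objective rho r b.
  by exists b => //; split=> // c /lb; rewrite bE.
have [hr|hr] := leP r (rho^-1 - 1).
  exists 1; first by rewrite in_itv /= ler01 lexx.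
  by rewrite valfun_small// /objective; ring.
have h : 1 - rho <= rho * r.
  by move/ltW: hr; rewrite -(ler_pM2l rho0) mulrBr mulfV ?gt_eqF// mulr1.
have hN : 0 <= rho * (1 - r) by apply: mulr_ge0; lra.
exists ((1 + rho * (1 - r)) / (2 * rho)).
  by rewrite in_itv /= divr_ge0 ?ler_pdivrMr ?mul1r; lra.
by rewrite valfun_large ?(ltW hr)// /objective; field; rewrite gt_eqF.
Qed.

Lemma Rstar_bounds rho n : 0 < rho < 1 -> 0 <= Rstar rho n <= rho ^+ n.
Proof.
move=> rho01; have [rho0 rho1] := andP rho01.
elim: n => [|n /andP[IH0 IH1]] /=; first by rewrite expr0 ler01 lexx.
have r1 : 0 <= Rstar rho n <= 1.
  by rewrite IH0 (le_trans IH1)// exprn_ile1 ?ltW.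
have [b b01 [-> bmin]] := valfun_min rho01 r1.
apply/andP; split; last first.
  have : objective rho (Rstar rho n) b <= objective rho (Rstar rho n) 1.
    by apply: bmin; rewrite in_itv /= ler01 lexx.
  move=> /le_trans; apply; rewrite exprS.
  have : rho * Rstar rho n <= rho * rho ^+ n by rewrite ler_pM2l.
  rewrite /objective; lra.
move: b01; rewrite in_itv /= => /andP[b0 b1]; rewrite /objective.
have h1 : 0 <= rho * b * Rstar rho n by rewrite !mulr_ge0// ltW.
have h2 : 0 <= (1 - b) * (1 - rho * b).
  by rewrite mulr_ge0// subr_ge0// mulr_ile1// ltW.
lra.
Qed.

Lemma n0_least rho : 0 < rho < 1 ->
  Rstar rho (n0 rho) <= rho^-1 - 1 /\
  forall m, Rstar rho m <= rho^-1 - 1 -> (n0 rho <= m)%N.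
Proof.
move=> rho01; have [rho0 rho1] := andP rho01.
suff ex : exists n, Rstar rho n <= rho^-1 - 1.
  have [m mP mmin] := ex_minnP ex.
  apply: (@xgetPex _ 0%N [set n | Rstar rho n <= rho^-1 - 1 /\
    forall m, Rstar rho m <= rho^-1 - 1 -> (n <= m)%N]).
  by exists m.
have : (fun n => rho ^+ n) @ \oo --> (0 : R).
  by apply: cvg_expr; rewrite gtr0_norm.
have d0 : 0 < rho^-1 - 1 by rewrite subr_gt0 invf_gt1.
move=> /cvgrPdist_le /(_ _ d0) [n _ /(_ n (leqnn n))] /=.
rewrite sub0r normrN ger0_norm ?exprn_ge0 ?(ltW rho0)// => h.
have [_ Rn] := andP (Rstar_bounds n rho01).
by exists n; exact: le_trans Rn h.
Qed.

Lemma Rstar_tail rho k : 0 < rho < 1 ->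
  Rstar rho (k + n0 rho) = rho ^+ k * Rstar rho (n0 rho).
Proof.
move=> rho01; have [rho0 rho1] := andP rho01; have [h _] := n0_least rho01.
have [R0 _] := andP (Rstar_bounds (n0 rho) rho01).
elim: k => [|k IH] /=; first by rewrite mul1r.
rewrite IH valfun_small ?exprS ?mulrA//.
by apply: le_trans h; rewrite ler_piMl// exprn_ile1// ltW.
Qed.

Lemma Q_cvg_Qinf rho : 0 < rho < 1 -> Q n rho @[n --> \oo] --> Qinf rho.
Proof.
move=> rho01; have [rho0 rho1] := andP rho01.
rewrite -(cvg_shiftn (n0 rho)) /Q /Qinf gt_eqF//.
have -> : (fun k => (1 - rho ^+ (k + n0 rho).+1) / (1 - rho) *
             (Rstar rho (k + n0 rho) / rho ^+ (k + n0 rho))) =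
          (fun k => (1 - rho ^+ k * rho ^+ (n0 rho).+1) *
             (Rstar rho (n0 rho) / ((1 - rho) * rho ^+ n0 rho))).
  apply/funext => k; rewrite Rstar_tail// -addnS !exprD exprS.
  have k0 : rho ^+ k != 0 by rewrite expf_neq0 ?gt_eqF.
  have m0 : rho ^+ n0 rho != 0 by rewrite expf_neq0 ?gt_eqF.
  have r1 : 1 - rho != 0 by rewrite gt_eqF ?subr_gt0.
  move: (Rstar _ _) (rho ^+ k) (rho ^+ n0 rho) k0 m0 => x a b k0 m0.
  by field; rewrite ?k0 ?m0 ?r1.
set L := Rstar _ _ / _; set c := rho ^+ _.+1.
have g0 : (fun k => rho ^+ k) @ \oo --> (0 : R).
  by apply: cvg_expr; rewrite gtr0_norm.
have := cvgM (cvgB (cvg_cst (1 : R)) (cvgM g0 (cvg_cst c))) (cvg_cst L).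
by rewrite mul0r subr0 mul1r; apply.
Qed.

Lemma Rstar_half rho n : 0 < rho <= 1 / 2 -> Rstar rho n = rho ^+ n.
Proof.
move=> /andP[rho0 rho2].
have h : 1 <= rho^-1 - 1.
  by rewrite lerBrDr -(ler_pM2l rho0) mulfV ?gt_eqF//; lra.
elim: n => [//|n IH] /=; rewrite IH valfun_small ?exprS//.
by apply: le_trans h; rewrite exprn_ile1//; lra.
Qed.

Lemma n0_half rho : 0 < rho <= 1 / 2 -> n0 rho = 0%N.
Proof.
move=> /andP[rho0 rho2]; have rho01 : 0 < rho < 1 by lra.
have [_ /(_ 0%N)] := n0_least rho01; rewrite leqn0 => h; apply/eqP/h => /=.
by rewrite lerBrDr -(ler_pM2l rho0) mulfV ?gt_eqF//; lra.
Qed.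

Lemma Q_cvg_at0 n : Q n rho @[rho --> (0 : R)^'+] --> Q n 0.
Proof.
rewrite {2}/Q eqxx.
have h : (1 - rho ^+ n.+1) / (1 - rho) @[rho --> (0 : R)^'+] --> (1 : R).
  apply: cvg_at_right_filter.
  have e0 : (1 - x) @[x --> (0 : R)] --> (1 - 0 : R).
    by apply: cvgB; [exact: cvg_cst|exact: cvg_id].
  have e1 : 1 - 0 != 0 :> R by rewrite subr0 oner_eq0.
  have := cvgM (cvgB (cvg_cst (1 : R)) (@exprn_continuous R n.+1 0))
    (cvgV e1 e0).
  by rewrite expr0n !subr0 invr1 mulr1; apply.
apply: cvg_trans h; apply: near_eq_cvg; near=> rho.
have rho0 : 0 < rho by [].
rewrite /Q gt_eqF// Rstar_half; first by rewrite divff ?mulr1// expf_neq0 ?gt_eqF.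
by rewrite rho0 /=; near: rho; apply: nbhs_right_le; lra.
Unshelve. all: by end_near. Qed.

Lemma Qinf_cvg_at0 : Qinf rho @[rho --> (0 : R)^'+] --> Qinf 0.
Proof.
rewrite {2}/Qinf eqxx.
have h : (1 - rho)^-1 @[rho --> (0 : R)^'+] --> (1 : R).
  apply: cvg_at_right_filter.
  have e0 : (1 - x) @[x --> (0 : R)] --> (1 - 0 : R).
    by apply: cvgB; [exact: cvg_cst|exact: cvg_id].
  have e1 : 1 - 0 != 0 :> R by rewrite subr0 oner_eq0.
  have := cvgV e1 e0.
  by rewrite !subr0 invr1; apply.
apply: cvg_trans h; apply: near_eq_cvg; near=> rho.
have rho0 : 0 < rho by [].
rewrite /Qinf gt_eqF// n0_half /= ?expr0 ?mulr1 ?mul1r//.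
by rewrite rho0 /=; near: rho; apply: nbhs_right_le; lra.
Unshelve. all: by end_near. Qed.

End Facts.

(* Main.v *)
Require Import Defs.
From mathcomp Require Import all_boot all_order all_algebra.
From mathcomp Require Import all_classical all_reals all_analysis.
From mathcomp Require Import ring lra zify.
Import Order.TTheory GRing.Theory Num.Theory.
Local Open Scope ring_scope.

(** The substitution [z_n = (rho * R_n + 1 - rho) / 4] turns the recursion of
    the [R_n], as long as [R_n >= 1 / rho - 1], into [z_0 = 1 / 4] and
    [z_(n+1) = z_n * (1 - z_n)], which no longer involves [rho] and gives
    [z_n <= 1 / (n + 4)].  In these terms [Q_n <= Q_(n+1)] reads
    [(2 z_n - (1 - rho))^2 <= 4 z_n^2 rho^(n+2)], a consequence of Bernoulli's
    inequality; past [n0] the quotient [Q_n / Qinf] is [1 - rho^(n+1)].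
    For the bound [e^2] put [N = n0] and let [N > 0]: from
    [1 - rho < 2 z_(N-1) <= 2 / (N + 3)] one gets
    [Qinf <= rho^-(N+1) <= (1 + 2 / (N + 1))^(N+1) <= e^2]. *)

Lemma bernoulli_le {R : realDomainType} {x : R} (k : nat) :
  0 <= x <= 1 -> 1 - k%:R * x <= (1 - x) ^+ k.
Proof.
move=> /andP[x0 x1]; elim: k => [|k IH]; first by rewrite mul0r subr0 expr0.
rewrite exprS.
have h1 : (1 - x) * (1 - k%:R * x) <= (1 - x) * (1 - x) ^+ k.
  by rewrite ler_wpM2l// subr_ge0.
have h2 : 0 <= k%:R * x ^+ 2 by rewrite mulr_ge0// sqr_ge0.
by rewrite -natr1; lra.
Qed.

Fixpoint logistic (R : realType) (n : nat) : R :=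
  if n is m.+1 then logistic R m * (1 - logistic R m) else 4^-1.

Lemma logistic_bounds (R : realType) (n : nat) :
  0 < logistic R n /\ (n%:R + 4) * logistic R n <= 1.
Proof.
elim: n => [|n [IH0 IH1]] /=; first by split; lra.
move: (logistic R n) IH0 IH1 => z z0 h.
have nz : 0 <= n%:R * z by rewrite mulr_ge0// ltW.
have z1 : z < 1 by lra.
split; first by rewrite mulr_gt0// subr_gt0.
rewrite -natr1; set a := n%:R + 4 in h *.
have -> : n%:R + 1 + 4 = a + 1 by rewrite /a; ring.
(* The induction step rests on [1 - (a + 1) * z * (1 - z) = (1 - a * z) * (1 - z) + z ^+ 2]. *)
have h1 : 0 <= (1 - a * z) * (1 - z) by rewrite mulr_ge0// subr_ge0// ltW.
have h2 := sqr_ge0 z; lra.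
Qed.

Lemma le_inv_sub1 {R : realType} {rho : R} (r : R) : 0 < rho ->
  (r <= rho^-1 - 1) = (rho * r <= 1 - rho).
Proof.
by move=> rho0; rewrite -(ler_pM2l rho0) mulrBr mulfV ?gt_eqF// mulr1.
Qed.

Lemma Rstar_gt {R : realType} {rho : R} {n : nat} :
  0 < rho < 1 -> (n < n0 rho)%N -> 1 - rho < rho * Rstar rho n.
Proof.
move=> rho01; have [rho0 _] := andP rho01.
move=> nlt; rewrite ltNge -le_inv_sub1//; apply/negP.
by move=> /(proj2 (n0_least rho01)); rewrite leqNgt nlt.
Qed.

(** With [4 * z = rho * r + 1 - rho], the minimum in the interior case is
    [1 - (1 - 2 * z) ^+ 2 / rho]. The index [n0 rho] itself is included, since the step to [n.+1]
    only needs [Rstar rho n] to lie above the threshold. *)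
Lemma Rstar_logistic {R : realType} {rho : R} {n : nat} :
  0 < rho < 1 -> (n <= n0 rho)%N ->
  rho * Rstar rho n = 4 * logistic R n - (1 - rho).
Proof.
move=> rho01; have [rho0 rho1] := andP rho01.
elim: n => [|n IH] nle /=; first by lra.
have h := Rstar_gt rho01 nle.
have [R0 Rle] := andP (Rstar_bounds n rho01).
have {}IH := IH (ltnW nle).
have R1 : Rstar rho n <= 1 by rewrite (le_trans Rle)// exprn_ile1// ltW.
rewrite valfun_large//; last first.
  rewrite -(ler_pM2l rho0) mulrBr mulfV ?gt_eqF// mulr1; exact: ltW.
have -> : logistic R n = (rho * Rstar rho n + (1 - rho)) / 4.
  by rewrite IH; field.
by field; rewrite gt_eqF.
Qed.

Lemma logistic_gt {R : realType} {rho : R} {n : nat} :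
  0 < rho < 1 -> (n < n0 rho)%N -> 1 - rho < 2 * logistic R n.
Proof.
move=> rho01 nlt; have := Rstar_gt rho01 nlt.
by rewrite (Rstar_logistic rho01) ?(ltnW nlt)//; lra.
Qed.

(** For [k] about [(n + 4) / 2] the bound on [z] gives [2 * z * k <= 1], so Bernoulli yields
    [2 * z - (1 - rho) <= 2 * z * rho ^+ k]. The left side is positive before [n0 rho], so this may
    be squared. *)
Lemma logistic_sqr_le {R : realType} {rho : R} {n : nat} :
  0 < rho < 1 -> (n < n0 rho)%N ->
  (2 * logistic R n - (1 - rho)) ^+ 2 <= 4 * logistic R n ^+ 2 * rho ^+ n.+2.
Proof.
move=> rho01; have [rho0 rho1] := andP rho01.
move=> nlt; have hz := logistic_gt rho01 nlt.
have [z0 z1] := logistic_bounds R n.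
move: (logistic R n) hz z0 z1 => z hz z0 z1.
(* Rounding (n + 4) / 2 down costs at most one of the two spare factors rho. *)
have [k kle kge] : exists2 k, 2 * k%:R <= n%:R + 4 :> R & (n.+2 <= k * 2)%N.
  by exists (n.+4)./2; [rewrite -!natrD -natrM ler_nat|]; lia.
have B : 1 - k%:R * (1 - rho) <= rho ^+ k.
  have m01 : 0 <= 1 - rho <= 1 by apply/andP; split; lra.
  by have := bernoulli_le k m01; rewrite subKr.
have h1 : 2 * z * k%:R <= 1.
  have : z * (2 * k%:R) <= z * (n%:R + 4) by rewrite ler_pM2l.
  lra.
have h2 : 2 * z - (1 - rho) <= 2 * z * rho ^+ k.
  have : 2 * z * (1 - k%:R * (1 - rho)) <= 2 * z * rho ^+ k.
    by rewrite ler_pM2l//; lra.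
  apply: le_trans.
  have : 2 * z * k%:R * (1 - rho) <= 1 * (1 - rho).
    by rewrite ler_wpM2r//; lra.
  lra.
have h3 : (2 * z - (1 - rho)) ^+ 2 <= (2 * z * rho ^+ k) ^+ 2.
  by rewrite lerXn2r// nnegrE; [lra|rewrite !mulr_ge0 ?exprn_ge0//; lra].
apply: (le_trans h3); rewrite exprMn -exprM.
have -> : (2 * z) ^+ 2 = 4 * z ^+ 2 by ring.
apply: ler_wpM2l; first by rewrite mulr_ge0// sqr_ge0.
by apply: ler_wiXn2l kge; lra.
Qed.

Lemma Q_le_succ {R : realType} {rho : R} {n : nat} :
  0 < rho < 1 -> (n < n0 rho)%N -> Q n rho <= Q n.+1 rho.
Proof.
move=> rho01; have [rho0 rho1] := andP rho01.
move=> nlt; have hS := Rstar_logistic rho01 nlt.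
have h := Rstar_logistic rho01 (ltnW nlt).
have key := logistic_sqr_le rho01 nlt.
rewrite /Q gt_eqF//.
have -> : (1 - rho ^+ n.+1) / (1 - rho) * (Rstar rho n / rho ^+ n) =
    (rho - rho ^+ n.+2) * (rho * Rstar rho n) / ((1 - rho) * rho ^+ n.+2).
  by rewrite !exprS; field; rewrite expf_neq0 ?gt_eqF ?subr_gt0.
have -> : (1 - rho ^+ n.+2) / (1 - rho) * (Rstar rho n.+1 / rho ^+ n.+1) =
    (1 - rho ^+ n.+2) * (rho * Rstar rho n.+1) / ((1 - rho) * rho ^+ n.+2).
  rewrite !exprS; move: (Rstar rho n.+1) => x.
  by field; rewrite expf_neq0 ?gt_eqF ?subr_gt0.
have d0 : 0 < (1 - rho) * rho ^+ n.+2 by rewrite mulr_gt0 ?exprn_gt0 ?subr_gt0.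
rewrite ler_pM2r ?invr_gt0// h hS /=.
(* For [q = rho ^+ n.+2], the right numerator minus the left one is exactly [4 * z ^+ 2 * q - (2 * z
   - (1 - rho)) ^+ 2]. *)
by move: (logistic R n) (rho ^+ n.+2) key => z q key; lra.
Qed.

Lemma Q_le_Qinf_large {R : realType} {rho : R} {n : nat} :
  0 < rho < 1 -> (n0 rho <= n)%N -> Q n rho <= Qinf rho.
Proof.
move=> rho01; have [rho0 rho1] := andP rho01.
move=> /subnK <-; move: (n - _)%N => k.
rewrite /Q /Qinf gt_eqF// Rstar_tail//.
have [R0 _] := andP (Rstar_bounds (n0 rho) rho01).
have -> : (1 - rho ^+ (k + n0 rho).+1) / (1 - rho) *
      (rho ^+ k * Rstar rho (n0 rho) / rho ^+ (k + n0 rho)) =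
    (1 - rho ^+ (k + n0 rho).+1) *
      (Rstar rho (n0 rho) / ((1 - rho) * rho ^+ n0 rho)).
  have k0 : rho ^+ k != 0 by rewrite expf_neq0 ?gt_eqF.
  have N0 : rho ^+ n0 rho != 0 by rewrite expf_neq0 ?gt_eqF.
  rewrite (exprD rho k); move: (1 - rho ^+ _) (Rstar _ _) => a b.
  move: (rho ^+ k) (rho ^+ n0 rho) k0 N0 => p q k0 N0.
  by field; rewrite ?k0 ?N0 ?gt_eqF ?subr_gt0.
apply: ler_piMl; last by rewrite lerBlDr lerDl exprn_ge0// ltW.
by rewrite divr_ge0// mulr_ge0 ?exprn_ge0 ?subr_ge0 ?ltW.
Qed.

Lemma Q_le_Qinf {R : realType} {rho : R} (n : nat) :
  0 < rho < 1 -> Q n rho <= Qinf rho.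
Proof.
move=> rho01; have [nle|nlt] := leqP n (n0 rho);
  last exact/(Q_le_Qinf_large rho01)/ltnW.
(* Monotonicity is available only up to [n0 rho], so the induction runs downwards from there, on the
   distance [k]. *)
suff H k : (k <= n0 rho)%N -> Q (n0 rho - k) rho <= Qinf rho.
  by rewrite -(subKn nle) H// leq_subr.
elim: k => [|k IH] kle; first by rewrite subn0 Q_le_Qinf_large.
apply: le_trans (IH (ltnW kle)); rewrite -(subnSK kle).
by apply: (Q_le_succ rho01); rewrite ltn_subrL (leq_ltn_trans _ kle).
Qed.

Lemma Qinf_le_expR2 {R : realType} {rho : R} :
  0 < rho < 1 -> Qinf rho <= expR 2.
Proof.
move=> rho01; have [rho0 rho1] := andP rho01.
rewrite /Qinf gt_eqF//.
have m0 : 0 < 1 - rho by rewrite subr_gt0.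
have [+ _] := n0_least rho01; rewrite le_inv_sub1//.
(* At [n0 rho = 0] there is no preceding index to bound [rho], but then [rho <= 1 - rho] and the
   quotient is at most 2. Otherwise [n0 rho = N.+1], and [logistic_gt] is applied at [N]. *)
case: (n0 rho) (@logistic_gt R rho) => [|N] zgt Rle.
  rewrite /= expr0 mulr1 in Rle *.
  apply: (@le_trans _ _ (1 + 2)); last exact: expR_ge1Dx.
  by rewrite ler_pdivrMr//; lra.
have {}zgt := zgt N rho01 (leqnn _).
have [z0 z1] := logistic_bounds R N.
have n1 : 0 <= N%:R :> R by [].
have hm : (N%:R + 4) * (1 - rho) <= 2.
  have : (N%:R + 4) * (1 - rho) <= (N%:R + 4) * (2 * logistic R N).
    by rewrite ler_pM2l ?(ltW zgt)//; lra.
  lra.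
(* The threshold [rho * Rstar rho N.+1 <= 1 - rho] cancels the factor [1 - rho] at the cost of one
   more [rho^-1]. *)
apply: (@le_trans _ _ (rho ^- N.+2)).
  rewrite ler_pdivrMr ?mulr_gt0 ?exprn_gt0//.
  have -> : rho ^- N.+2 * ((1 - rho) * rho ^+ N.+1) = (1 - rho) / rho.
    by rewrite !exprS; field; rewrite !expf_neq0 ?gt_eqF.
  by rewrite ler_pdivlMr// mulrC.
(* Comparing bases of the [N.+2]-th powers leaves [rho^-1 <= 1 + 2 / (N + 2)], which is [hm]
   rearranged. *)
have -> : expR 2 = expR (2 / (N.+2)%:R) ^+ N.+2 :> R.
  by rewrite -expRM_natl mulrC divfK.
have r0 : 0 <= rho^-1 by rewrite invr_ge0 ltW.
rewrite -exprVn lerXn2r ?nnegrE ?expR_ge0//.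
apply: le_trans (expR_ge1Dx _).
have NE : (N.+2)%:R = N%:R + 2 :> R by rewrite -addn2 natrD.
have N2 : 0 < N%:R + 2 :> R by lra.
rewrite -(ler_pM2l rho0) mulfV ?gt_eqF// NE -(ler_pM2r N2).
have -> : rho * (1 + 2 / (N%:R + 2)) * (N%:R + 2) = rho * (N%:R + 4) :> R.
  by field; rewrite gt_eqF.
lra.
Qed.

Theorem proposition4 (R : realType) (n : nat) (rho : R) (hrho : 0 <= rho < 1) :
  Q n rho <= Qinf rho <= expR 2.
Proof.
have [rho_ge0 rho1] := andP hrho.
have [->|rhoN0] := eqVneq rho 0.
  rewrite /Q /Qinf eqxx lexx /=.
  by apply: le_trans (expR_ge1Dx 2); lra.
have rho01 : 0 < rho < 1 by rewrite lt0r rhoN0 rho_ge0 rho1.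
by apply/andP; split; [exact: Q_le_Qinf|exact: Qinf_le_expR2].
Qed.
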